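(* Let $(\mathcal{S},d_{\mathcal{S}})$ be a metric state space and consider two Markov reward processes (single action $a$) with the same state-dependent reward $R:\mathcal{S}\to\mathbb{R}$ and discount $\gamma\in[0,1)$, differing only in their transition functions $T$ and $\widehat T$. Assume $\widehat T$ is induced by a Lipschitz model class with constant $K_F$, that $\widehat T$ is $\Delta$-accurate, i.e. $W(\widehat T(\cdot\mid s,a),T(\cdot\mid s,a))\le\Delta$ for all $s$, that $T$ is Lipschitz on distributions with constant $K_T:=\sup_{\mu_1,\mu_2}\frac{W(T(\cdot\mid\mu_1,a),T(\cdot\mid\mu_2,a))}{W(\mu_1,\mu_2)}$, and let $\bar K=\min\{K_F,K_T\}$. Assume $R$ is Lipschitz with constant $K_R=\sup_{s_1\ne s_2}\frac{|R(s_1)-R(s_2)|}{d_{\mathcal{S}}(s_1,s_2)}$. Then for all $s\in\mathcal{S}$, if $\bar K\in[0,1/\gamma)$, $$\big|V_T(s)-V_{\widehat T}(s)\big|\le\frac{\gamma K_R\Delta}{(1-\gamma)(1-\gamma\bar K)}.$$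
   Context: $W$ is the first Wasserstein metric on probability distributions on $(\mathcal{S},d_{\mathcal{S}})$. A Lipschitz model class is a collection $F$ of functions $f:\mathcal{S}\to\mathcal{S}$ with a probability distribution $g(\cdot\mid a)$ over $F$ (independent of the state) such that $K_F:=\sup_{f\in F}\sup_{s_1\ne s_2}\frac{d_{\mathcal{S}}(f(s_1),f(s_2))}{d_{\mathcal{S}}(s_1,s_2)}<\infty$; its induced transition function is $\widehat T(s'\mid s,a)=\sum_f\mathbb{1}(f(s)=s')g(f\mid a)$. A transition $P$ acts on a distribution $\mu$ by $P(s'\mid\mu,a)=\int P(s'\mid s,a)\mu(s)ds$, and $P^n(\cdot\mid\mu)$ denotes $n$ successive applications (with $P^0(\cdot\mid\mu)=\mu$). With $\delta_s$ the Dirac distribution at $s$, the value functions are $V_T(s)=\sum_{n=0}^\infty\gamma^n\int T^n(s'\mid\delta_s)R(s')\,ds'$ and $V_{\widehat T}(s)=\sum_{n=0}^\infty\gamma^n\int\widehat T^n(s'\mid\delta_s)R(s')\,ds'$. *)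

(* Defs.v *)
From HB Require Import structures.
From mathcomp Require Import all_boot all_order all_algebra.
From mathcomp Require Import all_classical all_reals all_analysis.

Set Implicit Arguments.
Unset Strict Implicit.
Unset Printing Implicit Defensive.
Import Order.TTheory GRing.Theory Num.Theory.
Import numFieldNormedType.Exports.
Local Open Scope classical_set_scope.
Local Open Scope ring_scope.

Section Defs.
Context {R : realType}.

Definition is_metric {S : Type} (dS : S -> S -> R) : Prop :=
  [/\ forall x y, 0 <= dS x y,
      forall x y, dS x y = 0 <-> x = y,
      forall x y, dS x y = dS y x &
      forall x y z, dS x z <= dS x y + dS y z].

Definition metric_open {S : Type} (dS : S -> S -> R) : set (set S) :=
  [set U | forall x, U x -> exists2 r : R, 0 < r & [set y | dS x y < r] `<=` U].

Definition lipc {X Y : Type} (dX : X -> X -> R) (dY : Y -> Y -> R) (f : X -> Y)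
  : \bar R :=
  ereal_sup [set z | exists x y, x <> y /\ z = (dY (f x) (f y) / dX x y)%:E].

Definition dR (x y : R) : R := `|x - y|.

Context {d : measure_display} {S : measurableType d}.

Definition Wass (dS : S -> S -> R) (mu nu : {measure set S -> \bar R}) : \bar R :=
  ereal_sup [set (\int[mu]_x (f x)%:E - \int[nu]_x (f x)%:E)%E
            | f in [set f : S -> R | forall x y, `|f x - f y| <= dS x y]].

Definition kiter (k : R.-spker S ~> S) : nat -> R.-spker S ~> S :=
  fix it n := match n with
  | 0 => (kdirac (@measurable_id _ S setT) : R.-spker S ~> S)
  | n.+1 => (mkcomp_noparam (it n) k : R.-spker S ~> S)
  end.

Definition kact (k : R.-spker S ~> S) (mu : probability S R)
  : {measure set S -> \bar R} :=
  mkcomp_noparam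
    (kprobability (measurable_cst (mu : pprobability S R) : measurable_fun [set: unit] _)
      : R.-spker unit ~> S) k tt.

Definition value (k : R.-spker S ~> S) (Rf : S -> R) (gamma : R) (s : S) : R :=
  limn (series (fun n => gamma ^+ n * Rintegral (kiter k n s) setT Rf)).

End Defs.

(* Main.v *)
(** For a bounded Lipschitz f, write kf(y) for the integral of f against k(y).
    One of the two kernels, call it k, maps L-Lipschitz bounded functions to
    (L * Kbar)-Lipschitz ones: T by comparing Dirac masses, That because it is a
    mixture of deterministic maps. Splitting
      k^(n+1) f - l^(n+1) f = (k^n - l^n)(kf) + l^n (kf - lf)
    gives |k^n f - l^n f| <= L * Delta * (1 + Kbar + ... + Kbar^(n-1)), and summing
    against gamma^n gives the bound. The distributions involved may have infinite
    first moments, so general Lipschitz functions need not be integrable; this is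
    why the recursion runs on bounded functions only, and the integrable reward is
    reached by truncation. *)
Require Import Defs.
From HB Require Import structures.
From mathcomp Require Import all_boot all_order all_algebra.
From mathcomp Require Import all_classical all_reals all_analysis.
From mathcomp Require Import measurable_realfun ring lra.
Import Order.TTheory GRing.Theory Num.Theory.
Import numFieldNormedType.Exports.
Local Open Scope classical_set_scope.
Local Open Scope ring_scope.

(** * Integrals of bounded functions against a measure of total mass one *)

Section BoundedIntegral.
Context {R : realType} {d : measure_display} {S : measurableType d}.
Variables (mu : {measure set S -> \bar R}) (mu1 : mu setT = 1%E).
Variables (f : S -> R) (M : R).
Hypotheses (mf : measurable_fun setT f) (fM : forall x, `|f x| <= M).

Lemma integrable_bounded : mu.-integrable setT (EFin \o f).
Proof.
apply: measurable_bounded_integrable => //; first by rewrite mu1 ltry.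
exists M; split; rewrite ?num_real// => y My x _ /=.
exact: le_trans (fM x) (ltW My).
Qed.

Lemma Rintegral_cst_prob (c : R) : Rintegral mu setT (fun=> c) = c.
Proof. by rewrite Rintegral_cst// mu1 mulr1. Qed.

Lemma integrable_cst_prob (c : R) : mu.-integrable setT (EFin \o (fun=> c)).
Proof.
apply: measurable_bounded_integrable => //; first by rewrite mu1 ltry.
exact: bounded_cst.
Qed.

Lemma RintegralD_cst (c : R) :
  Rintegral mu setT (fun x => f x + c) = Rintegral mu setT f + c.
Proof.
rewrite RintegralD//; last exact: integrable_cst_prob.
  by rewrite Rintegral_cst_prob.
exact: integrable_bounded.
Qed.

Lemma normr_Rintegral_bounded : `|Rintegral mu setT f| <= M.
Proof.
apply: le_trans (le_normr_Rintegral _ integrable_bounded) _ => //.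
rewrite -[leRHS]Rintegral_cst_prob; apply: le_Rintegral => //.
- have := integrable_abse integrable_bounded.
  by apply: eq_integrable.
- exact: integrable_cst_prob.
Qed.

Lemma EFin_Rintegral_bounded :
  (Rintegral mu setT f)%:E = (\int[mu]_x (f x)%:E)%E.
Proof.
by rewrite fineK//; apply: integrable_fin_num => //; exact: integrable_bounded.
Qed.

End BoundedIntegral.

(** * Integration against a composite of kernels *)

Section Composition.
Context {R : realType} {d0 d1 d2 : measure_display} {T0 : measurableType d0}
  {T1 : measurableType d1} {T2 : measurableType d2}.
Variables (k1 : R.-spker T0 ~> T1) (k2 : R.-spker T1 ~> T2).

Lemma integral_mkcomp_noparam (x : T0) (f : T2 -> \bar R) :
  (forall z, 0 <= f z)%E -> measurable_fun [set: T2] f ->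
  (\int[mkcomp_noparam k1 k2 x]_z f z =
   \int[k1 x]_y (\int[k2 y]_z f z))%E.
Proof.
move=> f0 mf.
exact: (integral_kcomp k1 (kernel.kernel_snd k2)).
Qed.

Hypothesis k2_prob : forall y, k2 y setT = 1%E.

(** Measurability of kernel integrals is available for nonnegative integrands. Adding [M] makes [f]
    nonnegative, and since every [k2 y] has mass one this only shifts the integral by [M]. *)
Lemma measurable_Rintegral_kernel (f : T2 -> R) (M : R) :
  measurable_fun [set: T2] f -> (forall x, `|f x| <= M) ->
  measurable_fun setT (fun y => Rintegral (k2 y) setT f).
Proof.
move=> mf fM.
have -> : (fun y => Rintegral (k2 y) setT f) =
    (fun y => fine (\int[k2 y]_z (f z + M)%:E)%E - M).
  apply/funext => y; have := RintegralD_cst _ (k2_prob y) _ _ mf fM M.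
  by rewrite /Rintegral => ->; rewrite addrK.
apply: measurable_funB => //; apply: measurableT_comp => //.
apply: measurable_fun_integral_kernel.
- exact: measurable_kernel.
- by move=> z; rewrite lee_fin; have := fM z; rewrite ler_norml; lra.
- by apply/measurable_EFinP; exact: measurable_funD.
Qed.

Lemma mkcomp_noparam_prob x : k1 x setT = 1%E ->
  mkcomp_noparam k1 k2 x setT = 1%E.
Proof.
move=> k1x; rewrite /mkcomp_noparam /= /kcomp_noparam.
by under eq_integral do rewrite k2_prob; rewrite integral_cst// k1x mule1.
Qed.

(** The nonnegative composition formula is applied to [f + M]. The shift adds exactly [M] to both
    sides, as all measures involved have mass one, so it cancels. *)
Lemma Rintegral_mkcomp_noparam x (f : T2 -> R) (M : R) : k1 x setT = 1%E ->
  measurable_fun [set: T2] f -> (forall x, `|f x| <= M) ->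
  Rintegral (mkcomp_noparam k1 k2 x) setT f =
  Rintegral (k1 x) setT (fun y => Rintegral (k2 y) setT f).
Proof.
move=> k1x mf fM.
have mfM : measurable_fun setT (fun z => f z + M) by exact: measurable_funD.
have bfM z : `|f z + M| <= M + M.
  by rewrite (le_trans (ler_normD _ _))// lerD// ger0_norm// (le_trans _ (fM z)).
have k2f y : `|Rintegral (k2 y) setT f| <= M.
  exact: normr_Rintegral_bounded.
apply: (addIr M); rewrite -(RintegralD_cst _ _ _ M _ _ M)//; last first.
  exact: mkcomp_noparam_prob.
rewrite -(RintegralD_cst _ _ _ M _ _ M)//; last first.
  exact: measurable_Rintegral_kernel mf fM.
rewrite /Rintegral integral_mkcomp_noparam//; last first.
- exact/measurable_EFinP.
- by move=> z; rewrite lee_fin; have := fM z; rewrite ler_norml; lra.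
congr fine; apply: eq_integral => y _.
rewrite -(EFin_Rintegral_bounded _ _ _ (M + M))//.
by rewrite (RintegralD_cst _ _ _ M).
Qed.

End Composition.

(** * Lipschitz functions, Wasserstein duality and Lipschitz kernels *)

Section LipschitzBorel.
Context {R : realType} {d : measure_display} {S : measurableType d}.
Variables (dS : S -> S -> R) (HdS : is_metric dS).
Hypothesis Hborel : @measurable d S = <<s metric_open dS >>.

Definition lipschitz_with (L : R) (f : S -> R) : Prop :=
  forall x y, `|f x - f y| <= L * dS x y.

Let dS_ge0 x y : 0 <= dS x y. Proof. by case: HdS. Qed.

Let dSxx x : dS x x = 0. Proof. by case: HdS => _ h _ _; apply/h. Qed.

(** The rays above [a] generate the Borel sets of the line, and their preimages under [f] are open
    for the metric. *)
Lemma lipschitz_with_measurable (L : R) (f : S -> R) :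
  0 <= L -> lipschitz_with L f -> measurable_fun setT f.
Proof.
move=> L0 fL; apply: (@measurability _ _ S R setT f (@RGenOInfty.G R)).
  exact: RGenOInfty.measurableE.
move=> _ [_ [a ->] <-]; rewrite setTI Hborel; apply: sub_sigma_algebra => x /=.
rewrite in_itv/= andbT => afx.
(* The radius divides by [L + 1] rather than [L], which may be zero. *)
have L1 : 0 < L + 1 by lra.
exists ((f x - a) / (L + 1)); first by rewrite divr_gt0// subr_gt0.
move=> y /=; rewrite ltr_pdivlMr// in_itv/= andbT => xy.
by have := fL x y; have := dS_ge0 x y; rewrite ler_norml => h1 /andP[h2 h3]; nra.
Qed.

Lemma lipschitz_with_of_le (L : R) (f : S -> R) :
  (forall x y, f x - f y <= L * dS x y) -> lipschitz_with L f.
Proof.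
move=> fL x y; rewrite ler_norml fL andbT lerNl opprB.
by have [_ _ -> _] := HdS.
Qed.

(** After division by [L], [f] is 1-Lipschitz and hence a competitor in the supremum defining
    [Wass]. *)
Lemma le_Wass (mu nu : {measure set S -> \bar R}) (L M D : R) (f : S -> R) :
  mu setT = 1%E -> nu setT = 1%E ->
  0 <= L -> lipschitz_with L f -> (forall x, `|f x| <= M) ->
  (Wass dS mu nu <= D%:E)%E ->
  Rintegral mu setT f - Rintegral nu setT f <= L * D.
Proof.
move=> mu1 nu1 L0 fL fM munuD.
have mf := lipschitz_with_measurable _ _ L0 fL.
have intmu := integrable_bounded _ mu1 _ _ mf fM.
have intnu := integrable_bounded _ nu1 _ _ mf fM.
(* For [L = 0] the function is constant and the two integrals agree. *)
have [L_gt0|] := ltP 0 L; last first.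
  move=> L_le0; have {L_le0}L0' : L = 0 by apply/eqP; rewrite eq_le L_le0 L0.
  have -> : f = fun=> f point.
    apply/funext => x; apply/eqP.
    by rewrite -subr_eq0 -normr_le0 (le_trans (fL _ _))// L0' mul0r.
  by rewrite !Rintegral_cst_prob// subrr L0' mul0r.
have intE (m : {measure set S -> \bar R}) : m.-integrable setT (EFin \o f) ->
    (\int[m]_x (L^-1 * f x)%:E = (L^-1 * Rintegral m setT f)%:E)%E.
  move=> intm.
  rewrite -RintegralZl// /Rintegral fineK//.
  apply: integrable_fin_num => //.
  by have := integrableZl measurableT L^-1 intm; apply: eq_integrable.
suff : ((L^-1 * Rintegral mu setT f - L^-1 * Rintegral nu setT f)%:E <= D%:E)%E.
  by rewrite lee_fin -mulrBr ler_pdivrMl.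
apply: le_trans munuD; apply: ereal_sup_ubound => /=.
exists (fun x => L^-1 * f x); last by rewrite !intE.
move=> x y; rewrite -mulrBr normrM gtr0_norm ?invr_gt0//.
by rewrite ler_pdivrMl.
Qed.

Lemma Wass_dirac x y :
  Wass dS (dirac x : {measure set S -> \bar R}) (dirac y) = (dS x y)%:E.
Proof.
have h (f : S -> R) : (forall x y, `|f x - f y| <= dS x y) ->
    (\int[(dirac x : {measure set S -> \bar R})]_z (f z)%:E
     - \int[(dirac y : {measure set S -> \bar R})]_z (f z)%:E = (f x - f y)%:E)%E.
  move=> f1; have mf : measurable_fun setT f.
    by apply: (lipschitz_with_measurable 1) => // u v; rewrite mul1r.
  by rewrite !integral_dirac ?diracT ?mul1e//; exact/measurable_EFinP.
apply/eqP; rewrite eq_le; apply/andP; split.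
  apply: ge_ereal_sup => _ [f f1 <-]; rewrite h// lee_fin.
  exact: le_trans (ler_norm _) (f1 _ _).
(* The distance to [y] attains the supremum; it is 1-Lipschitz by the triangle inequality. *)
apply: ereal_sup_ubound; exists (dS^~ y).
  move=> u v /=; have [_ _ dC dT] := HdS.
  by rewrite ler_norml; have := dT u v y; have := dT v u y; rewrite (dC v u); lra.
rewrite h ?dSxx ?subr0// => u v; have [_ _ dC dT] := HdS.
by rewrite ler_norml; have := dT u v y; have := dT v u y; rewrite (dC v u); lra.
Qed.

(** The dual form of Lipschitz continuity on distributions, tested on bounded functions only. It is
    the common property through which both transitions enter the recursion. *)
Definition lipschitz_kernel (k : S -> {measure set S -> \bar R}) (K : R) : Prop :=
  forall (f : S -> R) (L M : R), 0 <= L -> lipschitz_with L f ->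
    (forall x, `|f x| <= M) ->
    lipschitz_with (L * K) (fun x => Rintegral (k x) setT f).

Lemma integral_kact_dirac (T : R.-pker S ~> S) (u : S) (h : S -> \bar R) :
  (\int[kact T (dirac u : probability S R)]_z h z = \int[T u]_z h z)%E.
Proof.
apply: eq_measure_integral => A mA _.
rewrite /kact /mkcomp_noparam /= /kcomp_noparam/= integral_dirac//.
  by rewrite diracT mul1e.
exact: measurable_kernel.
Qed.

Lemma Wass_lipschitz_kernel (T : R.-pker S ~> S) (K : R) : 0 <= K ->
  ereal_sup [set z | exists mu1 mu2 : probability S R,
            (0 < Wass dS mu1 mu2 < +oo)%E /\
            z = (Wass dS (kact T mu1) (kact T mu2) * ((fine (Wass dS mu1 mu2))^-1)%:E)%E]
         = K%:E ->
  lipschitz_kernel T K.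
Proof.
move=> K0 HK f L M L0 fL fM; apply: lipschitz_with_of_le => x y.
rewrite -mulrA; apply: (le_Wass _ _ _ M); rewrite ?prob_kernel//.
(* At equal points each competitor contributes 0, or [-oo] when its integral is infinite, by the
   convention for differences of equal infinities. *)
have [->|xy] := pselect (x = y).
  rewrite dSxx mulr0; apply: ge_ereal_sup => _ [h _ <-].
  have [fin|] := boolP ((\int[T y]_x (h x)%:E)%E \is a fin_num).
    by rewrite subee.
  by rewrite fin_numEn => /orP[] /eqP ->; rewrite ?addNye ?addeNy leNye.
have dxy : 0 < dS x y.
  rewrite lt0r dS_ge0 andbT; apply/eqP => d0; apply: xy.
  by have [_ h _ _] := HdS; apply/h.
have WE : Wass dS (kact T (dirac x : probability S R))
    (kact T (dirac y : probability S R)) = Wass dS (T x) (T y).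
  rewrite /Wass; congr (ereal_sup _).
  by apply: eq_imagel => h _; rewrite !integral_kact_dirac.
rewrite -WE EFinM -lee_pdivrMr//.
(* The pair of Dirac masses is admissible in the supremum: its distance is [dS x y], positive and
   finite. *)
rewrite -HK; apply: ereal_sup_ubound => /=.
exists (dirac x : probability S R), (dirac y : probability S R).
by rewrite Wass_dirac/= lte_fin dxy ltry.
Qed.

End LipschitzBorel.

(** * Countable mixtures of Dirac masses approximated by finite ones *)

Section Mixture.
Context {R : realType} {d : measure_display} {S : measurableType d}.
Variables (I : choiceType) (g : I -> R).
Hypotheses (Hg0 : forall i, 0 <= g i)
  (Hg1 : (\esum_(i in [set: I]) (g i)%:E = 1)%E).

(** The total weight 1 is the supremum of the finite partial sums, so one of them exceeds
    [1 - e]. *)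
Lemma mixture_weights_finite (e : R) : 0 < e ->
  exists2 J : seq I, uniq J & 1 - e < \sum_(i <- J) g i <= 1.
Proof.
move=> e0.
have : ((1 - e)%:E < \esum_(i in [set: I]) (g i)%:E)%E.
  by rewrite Hg1 lte_fin; lra.
move=> /ereal_sup_gt[_ [X [finX _] <-]] eX.
exists (finmap.enum_fset (fset_set X)); first exact: finmap.fset_uniq.
rewrite -!lte_fin -lee_fin -sumEFin -fsbig_finite// eX/= -Hg1.
by apply: esum_ge; exists X.
Qed.

Variables (mu : {measure set S -> \bar R}) (x : I -> S).
Hypothesis Hmu : forall A, measurable A ->
  mu A = (\esum_(i in [set: I]) (g i)%:E * \d_(x i) A)%E.

(** The left side is the integral of [h] against a finite sum of weighted Dirac masses. That measure
    lies below [mu] on every measurable set, and integrals of nonnegative functions are monotone in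
    the measure. *)
Lemma mixture_integral_ge (J : seq I) (h : S -> \bar R) : uniq J ->
  (forall z, 0 <= h z)%E -> measurable_fun setT h ->
  (\sum_(i <- J) (g i)%:E * h (x i) <= \int[mu]_z h z)%E.
Proof.
(* The head of a nonempty list serves as the default value of [nth]; [I] comes with no chosen
   element. *)
case: J => [|i0 J] uJ h0 mh; first by rewrite big_nil integral_ge0.
set K := i0 :: J in uJ *.
pose m_ n : {measure set S -> \bar R} :=
  mscale (NngNum (Hg0 (nth i0 K n))) (dirac (x (nth i0 K n))).
have -> : (\sum_(i <- K) (g i)%:E * h (x i) = \int[msum m_ (size K)]_z h z)%E.
  rewrite ge0_integral_measure_sum// (big_nth i0) big_mkord.
  apply: eq_bigr => n _.
  by rewrite ge0_integral_mscale//= integral_dirac// diracT mul1e.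
apply: ge0_le_measure_integral => // A mA.
rewrite Hmu//; apply: esum_ge; exists [set` K]; first by split.
rewrite -fsbig_seq// (big_nth i0) big_mkord.
by rewrite /msum.
Qed.

End Mixture.

(** * A mixture of Lipschitz maps is a Lipschitz kernel *)

Section MixtureKernel.
Context {R : realType} {d : measure_display} {S : measurableType d}.
Variables (dS : S -> S -> R) (HdS : is_metric dS).
Hypothesis Hborel : @measurable d S = <<s metric_open dS >>.
Variables (I : choiceType) (F : I -> S -> S) (g : I -> R).
Hypotheses (Hg0 : forall i, 0 <= g i)
  (Hg1 : (\esum_(i in [set: I]) (g i)%:E = 1)%E).

Lemma lipc_sup_le (K : R) : 0 <= K ->
  ereal_sup [set lipc dS dS (F i) | i in [set: I]] = K%:E ->
  forall i x y, dS (F i x) (F i y) <= K * dS x y.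
Proof.
move=> K0 HK i x y; have [d0 dP dC dT] := HdS.
have [->|xy] := pselect (x = y).
  by rewrite (dP _ _).2// mulr_ge0.
have dxy : 0 < dS x y.
  by rewrite lt0r d0 andbT; apply/eqP => xy0; apply: xy; apply/dP.
rewrite -ler_pdivrMr// -lee_fin -HK.
apply: (@le_trans _ _ (lipc dS dS (F i))).
  by apply: ereal_sup_ubound => /=; exists x, y.
by apply: ereal_sup_ubound => /=; exists i.
Qed.

Lemma mixture_lipschitz_kernel (k : R.-pker S ~> S) (K : R) : 0 <= K ->
  (forall i x y, dS (F i x) (F i y) <= K * dS x y) ->
  (forall s A, measurable A ->
     k s A = (\esum_(i in [set: I]) (g i)%:E * \d_(F i s) A)%E) ->
  lipschitz_kernel dS k K.
Proof.
move=> K0 FK Hk f L M L0 fL fM; apply: (lipschitz_with_of_le _ HdS) => x y.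
have mf := lipschitz_with_measurable _ HdS Hborel _ _ L0 fL.
have M0 : 0 <= M by rewrite (le_trans _ (fM point)).
have dxy0 : 0 <= dS x y by case: HdS.
(* Finitely many maps carry all but a small part of the mass; bounding the
   integrals of M + f and M - f, both nonnegative, from below by the finite sums
   avoids an exact formula for the integral against the mixture. *)
apply/ler_addgt0Pr => e e0.
have M1 : 0 < M + M + 1 by lra.
(* The missing mass gets multiplied by [M + M] below, so [e / (M + M + 1)] costs at most [e]; the
   added 1 keeps the denominator positive. *)
have [J uJ /andP[Jge Jle]] :=
  mixture_weights_finite _ _ Hg1 _ (divr_gt0 e0 M1).
have lower z (h : S -> R) N : measurable_fun setT h -> (forall t, `|h t| <= N) ->
    (forall t, 0 <= h t) ->
    \sum_(i <- J) g i * h (F i z) <= Rintegral (k z) setT h.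
  move=> mh hN h0.
  rewrite -lee_fin (EFin_Rintegral_bounded _ _ _ N)//; last exact: prob_kernel.
  rewrite -sumEFin.
  under eq_bigr do rewrite EFinM.
  apply: (mixture_integral_ge _ _ Hg0 _ (F^~ z) _ _ (EFin \o h)) => //.
  - by move=> A mA; exact: Hk.
  - exact/measurable_EFinP.
have Mf t : - M <= f t <= M by rewrite -ler_norml.
have low1 : \sum_(i <- J) g i * (f (F i y) + M) <= Rintegral (k y) setT f + M.
  rewrite -(RintegralD_cst _ _ _ M)//; last exact: prob_kernel.
  apply: (lower y (fun t => f t + M) (M + M)).
  - exact: measurable_funD.
  - by move=> t; have := Mf t; rewrite ler_norml; lra.
  - by move=> t; have := Mf t; lra.
have low2 : \sum_(i <- J) g i * (- f (F i x) + M) <= - Rintegral (k x) setT f + M.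
  rewrite -mulN1r -RintegralZl//; last first.
    by apply: (integrable_bounded _ _ _ M) => //; exact: prob_kernel.
  rewrite -(RintegralD_cst _ _ _ M)//.
  - under [in leRHS]eq_Rintegral do rewrite mulN1r.
    apply: (lower x (fun t => - f t + M) (M + M)).
    + by apply: measurable_funD => //; exact: measurableT_comp.
    + by move=> t; have := Mf t; rewrite ler_norml; lra.
    + by move=> t; have := Mf t; lra.
  - exact: prob_kernel.
  - by apply: measurable_funM.
  - by move=> t; rewrite mulN1r normrN.
(* Map by map, [f (F i x) - f (F i y)] is at most [L * (K * dS x y)], and the two shifts add
   [M + M]. *)
have sum_ge : \sum_(i <- J) g i * (M + M - L * (K * dS x y)) <=
    \sum_(i <- J) g i * (f (F i y) + M) + \sum_(i <- J) g i * (- f (F i x) + M).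
  rewrite -big_split/=; apply: ler_sum => i _; rewrite -mulrDr.
  apply: ler_wpM2l => //.
  have := fL (F i x) (F i y); rewrite ler_norml => /andP[_].
  have := ler_wpM2l L0 (FK i x y); lra.
rewrite -mulr_suml in sum_ge.
have KL0 : 0 <= L * (K * dS x y) by rewrite !mulr_ge0.
set w := \sum_(i <- J) g i in Jge Jle sum_ge.
have eE : e / (M + M + 1) * (M + M + 1) = e by rewrite divfK// gt_eqF.
have ee0 : 0 < e / (M + M + 1) by exact: divr_gt0.
have h1 : (1 - w) * (M + M) <= e.
  apply: le_trans (_ : e / (M + M + 1) * (M + M) <= _).
    by apply: ler_wpM2r; lra.
  by rewrite -[leRHS]eE; apply: ler_wpM2l; lra.
have h2 : w * (L * (K * dS x y)) <= L * (K * dS x y).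
  by rewrite ler_piMl.
rewrite -mulrA; lra.
Qed.

End MixtureKernel.

(** * Comparison of the iterates of two kernels *)

Lemma geometric_sum_rec {R : realType} (K : R) n :
  \sum_(i < n.+1) K ^+ i = 1 + K * \sum_(i < n) K ^+ i.
Proof.
rewrite big_ord_recl expr0 mulr_sumr; congr (_ + _).
by apply: eq_bigr => i _; rewrite exprS.
Qed.

Section Iterates.
Context {R : realType} {d : measure_display} {S : measurableType d}.

Lemma kiter_prob (k : R.-pker S ~> S) n s : kiter k n s setT = 1%E.
Proof.
elim: n => [|n IH]; first by rewrite /= diracT.
by apply: mkcomp_noparam_prob => // y; exact: prob_kernel.
Qed.

Lemma Rintegral_kiterS (k : R.-pker S ~> S) n s (f : S -> R) (M : R) :
  measurable_fun setT f -> (forall x, `|f x| <= M) ->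
  Rintegral (kiter k n.+1 s) setT f =
  Rintegral (kiter k n s) setT (fun y => Rintegral (k y) setT f).
Proof.
move=> mf fM; apply: (Rintegral_mkcomp_noparam _ _ _ _ _ M) => //.
- by move=> y; exact: prob_kernel.
- exact: kiter_prob.
Qed.

Variables (dS : S -> S -> R) (HdS : is_metric dS).
Hypothesis Hborel : @measurable d S = <<s metric_open dS >>.

(** Either transition can take the role of the Lipschitz kernel [k], which is how the minimum of the
    two constants arises. The induction keeps [f] and [L] general because the function changes at
    each step. *)
Lemma kiter_Rintegral_dist (k l : R.-pker S ~> S) (K D : R) : 0 <= K ->
  lipschitz_kernel dS k K ->
  (forall y (f : S -> R) (L M : R), 0 <= L -> lipschitz_with dS L f ->
    (forall x, `|f x| <= M) ->
    `|Rintegral (k y) setT f - Rintegral (l y) setT f| <= L * D) ->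
  forall n s (f : S -> R) (L M : R), 0 <= L -> lipschitz_with dS L f ->
    (forall x, `|f x| <= M) ->
  `|Rintegral (kiter k n s) setT f - Rintegral (kiter l n s) setT f|
    <= L * D * \sum_(i < n) K ^+ i.
Proof.
move=> K0 kK kl n s; elim: n => [|n IH] f L M L0 fL fM.
  by rewrite big_ord0 mulr0 /= subrr normr0.
have mf := lipschitz_with_measurable _ HdS Hborel _ _ L0 fL.
rewrite !(Rintegral_kiterS _ _ _ _ M)// geometric_sum_rec.
pose kf y := Rintegral (k y) setT f; pose lf y := Rintegral (l y) setT f.
have kfM y : `|kf y| <= M.
  by apply: normr_Rintegral_bounded => //; exact: prob_kernel.
have lfM y : `|lf y| <= M.
  by apply: normr_Rintegral_bounded => //; exact: prob_kernel.
have mkf : measurable_fun setT kf.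
  by apply: (measurable_Rintegral_kernel _ _ _ M) => // y; exact: prob_kernel.
have mlf : measurable_fun setT lf.
  by apply: (measurable_Rintegral_kernel _ _ _ M) => // y; exact: prob_kernel.
(* The induction hypothesis is used for [kf], with constant [L * K] and the same bound [M]. *)
have h1 := IH _ _ _ (mulr_ge0 L0 K0) (kK _ _ _ L0 fL fM) kfM.
(* The pointwise bound on [kf - lf] survives averaging against a probability. *)
have h2 : `|Rintegral (kiter l n s) setT kf - Rintegral (kiter l n s) setT lf| <= L * D.
  rewrite -RintegralB//; first last.
  - by apply: (integrable_bounded _ _ _ M) => //; exact: kiter_prob.
  - by apply: (integrable_bounded _ _ _ M) => //; exact: kiter_prob.
  apply: normr_Rintegral_bounded => //; first exact: kiter_prob.
    exact: measurable_funB.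
  by move=> y; exact: (kl _ _ _ M).
have -> : L * D * (1 + K * \sum_(i < n) K ^+ i) =
  L * K * D * (\sum_(i < n) K ^+ i) + L * D by ring.
apply: le_trans (lerD h1 h2).
by rewrite -[X in `|X| <= _](subrKA (Rintegral (kiter l n s) setT kf)) ler_normD.
Qed.

End Iterates.

(** * Truncation of integrable functions *)

Section Truncation.
Context {R : realType} {d : measure_display} {S : measurableType d}.

Definition truncation (m : R) (f : S -> R) (x : S) : R :=
  Num.max (- m) (Num.min m (f x)).

Lemma truncation_le m f x : 0 <= m -> `|truncation m f x| <= m.
Proof.
move=> m0; rewrite /truncation ler_norml le_max lexx/= ge_max ge_min lexx/=.
by rewrite andbT; lra.
Qed.

Lemma truncation_id m f x : `|f x| <= m -> truncation m f x = f x.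
Proof.
by rewrite ler_norml => /andP[h1 h2]; rewrite /truncation min_r// max_r.
Qed.

Lemma truncation_le_normr m f x : 0 <= m -> `|truncation m f x| <= `|f x|.
Proof.
move=> m0; have [/truncation_id -> //|mf] := leP `|f x| m.
by rewrite (le_trans (truncation_le _ _ _ m0))// ltW.
Qed.

(** Maximum and minimum with a constant are 1-Lipschitz, so truncation preserves Lipschitz
    constants. *)
Lemma truncation_dist m f x y :
  `|truncation m f x - truncation m f y| <= `|f x - f y|.
Proof.
rewrite /truncation.
have h (a u v : R) : `|Num.max a u - Num.max a v| <= `|u - v|.
  have := ler_norm (u - v); have := ler_norm (- (u - v)); rewrite normrN => ? ?.
  rewrite ler_norml.
  by case: (leP a u) => ?; case: (leP a v) => ?; lra.
have h' (a u v : R) : `|Num.min a u - Num.min a v| <= `|u - v|.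
  have := ler_norm (u - v); have := ler_norm (- (u - v)); rewrite normrN => ? ?.
  rewrite ler_norml.
  by case: (leP a u) => ?; case: (leP a v) => ?; lra.
exact: le_trans (h _ _ _) (h' _ _ _).
Qed.

Lemma Rintegral_truncation_cvg (mu : {measure set S -> \bar R}) (f : S -> R) :
  mu.-integrable setT (EFin \o f) ->
  (fun n => Rintegral mu setT (truncation n%:R f)) @ \oo --> Rintegral mu setT f.
Proof.
move=> intf; have mf : measurable_fun setT f.
  by apply/measurable_EFinP; exact: measurable_int intf.
have [_ _ h] : [/\ mu.-integrable setT (EFin \o f),
    [sequence \int[mu]_x (`|(truncation n%:R f x)%:E - (f x)%:E|)]_n%E @ \oo --> 0%E &
    [sequence \int[mu]_x (truncation n%:R f x)%:E]_n%E @ \oo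
      --> (\int[mu]_x (f x)%:E)%E].
  (* The dominating function is [|f|]; at each point the truncations are eventually equal to [f]. *)
  apply: (dominated_convergence measurableT _ _ _ (integrable_abse intf)).
  - move=> n; apply/measurable_EFinP; apply: measurable_maxr => //.
    exact: measurable_minr.
  - exact/measurable_EFinP.
  - apply: aeW => x _; apply: cvg_near_cst; near=> n.
    rewrite truncation_id//; near: n; exact: nbhs_infty_ger.
  - by apply: aeW => x n _; rewrite lee_fin truncation_le_normr.
apply: fine_cvg; rewrite fineK//.
exact: integrable_fin_num.
Unshelve. all: by end_near.
Qed.

End Truncation.

(** * Discounted sums of geometric sums *)

(** Induction on [N] through the fixed-point equation of the bound avoids the closed form of the
    inner sum, so [K = 1] needs no separate case. *)
Lemma discounted_geometric_sum_le {R : realType} (gamma K : R) N :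
  0 <= gamma < 1 -> 0 <= K -> gamma * K < 1 ->
  \sum_(n < N) gamma ^+ n * \sum_(i < n) K ^+ i
    <= gamma / ((1 - gamma) * (1 - gamma * K)).
Proof.
move=> /andP[g0 g1] K0 gK1.
set B := gamma / _.
have G N' : \sum_(n < N') gamma ^+ n <= (1 - gamma)^-1.
  rewrite -[leRHS]mul1r ler_pdivlMr ?subr_gt0//.
  elim: N' => [|n IH]; first by rewrite big_ord0 mul0r.
  by rewrite geometric_sum_rec; nra.
have BE : gamma * (1 - gamma)^-1 + gamma * K * B = B.
  by rewrite /B; field; apply/andP; split; lra.
elim: N => [|N IH].
  by rewrite big_ord0 /B divr_ge0// mulr_ge0; lra.
(* The term [n = 0] has an empty inner sum; unfolding the others once reproduces the equation
   [BE]. *)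
rewrite big_ord_recl big_ord0 mulr0 add0r -BE.
apply: (@le_trans _ _ (gamma * \sum_(n < N) gamma ^+ n
   + gamma * K * \sum_(n < N) gamma ^+ n * \sum_(i < n) K ^+ i)).
  rewrite !mulr_sumr -big_split/= ler_sum// => i _.
  by rewrite geometric_sum_rec exprS le_eqVlt; apply/orP; left; apply/eqP; ring.
by apply: lerD; apply: ler_wpM2l => //; rewrite mulr_ge0.
Qed.

(** * Passing from Wasserstein bounds and bounded functions to the reward *)

Section Estimates.
Context {R : realType} {d : measure_display} {S : measurableType d}.
Variables (dS : S -> S -> R) (HdS : is_metric dS).
Hypothesis Hborel : @measurable d S = <<s metric_open dS >>.

Lemma lipc_lipschitz_with (f : S -> R) (K : R) :
  lipc dS dR f = K%:E -> 0 <= K /\ lipschitz_with dS K f.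
Proof.
move=> fK; have [d0 dP _ _] := HdS.
have ub x y : x <> y -> `|f x - f y| / dS x y <= K.
  move=> xy; rewrite -lee_fin -fK; apply: ereal_sup_ubound => /=.
  by exists x, y.
split.
  (* On a one-point space the supremum is over the empty set and equals [-oo], which contradicts its
     being the real number [K]. *)
  have [[x [y xy]]|noxy] := pselect (exists x y : S, x <> y).
    by apply: le_trans (ub _ _ xy); rewrite divr_ge0.
  suff : lipc dS dR f = -oo%E by rewrite fK.
  rewrite /lipc (_ : [set _ | _] = set0) ?ereal_sup0//.
  by apply/seteqP; split => // z [x [y [xy _]]]; apply: noxy; exists x, y.
move=> x y; have [->|xy] := pselect (x = y).
  by rewrite subrr normr0 (dP _ _).2// mulr0.
rewrite -ler_pdivrMr; first exact: ub.
by rewrite lt0r d0 andbT; apply/eqP => xy0; apply: xy; apply/dP.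
Qed.

(** The one-sided estimate is applied to [f] and to [-f], which is Lipschitz with the same
    constant. *)
Lemma Rintegral_dist_le_Wass (mu nu : {measure set S -> \bar R}) (L M D : R)
    (f : S -> R) :
  mu setT = 1%E -> nu setT = 1%E ->
  0 <= L -> lipschitz_with dS L f -> (forall x, `|f x| <= M) ->
  (Wass dS mu nu <= D%:E)%E ->
  `|Rintegral mu setT f - Rintegral nu setT f| <= L * D.
Proof.
move=> mu1 nu1 L0 fL fM W.
have mf := lipschitz_with_measurable _ HdS Hborel _ _ L0 fL.
have RN (m : {measure set S -> \bar R}) : m setT = 1%E ->
    Rintegral m setT (fun x => -1 * f x) = - Rintegral m setT f.
  by move=> m1; rewrite RintegralZl ?mulN1r//; exact: (integrable_bounded _ _ _ M).
rewrite ler_norml; apply/andP; split; last first.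
  exact: (le_Wass _ HdS Hborel _ _ _ M).
have : Rintegral mu setT (fun x => -1 * f x) -
    Rintegral nu setT (fun x => -1 * f x) <= L * D.
  apply: (le_Wass _ HdS Hborel _ _ _ M) => // x.
    by move=> y; rewrite -mulrBr mulN1r normrN.
  by rewrite mulN1r normrN.
by rewrite !RN//; lra.
Qed.

(** Truncations of [f] are bounded and keep the constant [L], so the bound [C] holds for each and
    passes to the limit. *)
Lemma Rintegral_dist_truncation (mu nu : {measure set S -> \bar R}) (f : S -> R)
    (L C : R) : 0 <= L -> lipschitz_with dS L f ->
  mu.-integrable setT (EFin \o f) -> nu.-integrable setT (EFin \o f) ->
  (forall (h : S -> R) (M : R), lipschitz_with dS L h -> (forall x, `|h x| <= M) ->
    `|Rintegral mu setT h - Rintegral nu setT h| <= C) ->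
  `|Rintegral mu setT f - Rintegral nu setT f| <= C.
Proof.
move=> L0 fL muf nuf H.
have cv : (fun n => `|Rintegral mu setT (truncation n%:R f)
      - Rintegral nu setT (truncation n%:R f)|) @ \oo -->
    `|Rintegral mu setT f - Rintegral nu setT f|.
  by apply: cvg_norm; apply: cvgB; exact: Rintegral_truncation_cvg.
rewrite -(cvg_lim _ cv)//; apply: limr_le; first by apply/cvg_ex; eexists; exact: cv.
near=> n; apply: (H _ n%:R); last by move=> x; exact: truncation_le.
by move=> x y; exact: le_trans (truncation_dist _ _ _ _) (fL x y).
Unshelve. all: by end_near.
Qed.

End Estimates.

(** * Comparison of the value functions *)

Lemma lim_series_dist_le {R : realType} (u v : R^nat) (B : R) :
  cvgn (series u) -> cvgn (series v) ->
  (forall N, \sum_(n < N) `|u n - v n| <= B) ->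
  `|limn (series u) - limn (series v)| <= B.
Proof.
move=> cu cv uvB.
have cuv : (fun n => `|series u n - series v n|) @ \oo -->
    `|limn (series u) - limn (series v)|.
  by apply: cvg_norm; exact: cvgB.
rewrite -(cvg_lim _ cuv)//; apply: limr_le; first by apply/cvg_ex; eexists; exact: cuv.
apply: nearW => N.
rewrite /series/= -sumrB big_mkord.
exact: le_trans (ler_norm_sum _ _ _) (uvB N).
Qed.

Theorem theorem2 (R : realType) (d : measure_display) (S : measurableType d)
  (dS : S -> S -> R) (HdS : is_metric dS)
  (Hborel : @measurable d S = <<s metric_open dS >>)
  (gamma : R) (Hgamma : 0 <= gamma < 1)
  (Rf : S -> R) (KR : R) (HKR : lipc dS dR Rf = KR%:E)
  (T : R.-pker S ~> S)
  (KT : R)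
  (HKT : ereal_sup [set z | exists mu1 mu2 : probability S R,
            (0 < Wass dS mu1 mu2 < +oo)%E /\
            z = (Wass dS (kact T mu1) (kact T mu2) * ((fine (Wass dS mu1 mu2))^-1)%:E)%E]
         = KT%:E)
  (I : choiceType) (F : I -> S -> S) (g : I -> R)
  (Hg0 : forall i, 0 <= g i) (Hg1 : (\esum_(i in [set: I]) (g i)%:E = 1)%E)
  (KF : R) (HKF : ereal_sup [set lipc dS dS (F i) | i in [set: I]] = KF%:E)
  (That : R.-pker S ~> S)
  (HThat : forall s A, measurable A ->
     That s A = (\esum_(i in [set: I]) (g i)%:E * \d_(F i s) A)%E)
  (Delta : R) (HDelta : forall s, (Wass dS (That s) (T s) <= Delta%:E)%E)
  (s : S)
  (HintT : forall n, (kiter T n s).-integrable [set: S] (EFin \o Rf))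
  (HintThat : forall n, (kiter That n s).-integrable [set: S] (EFin \o Rf))
  (HcvgT : cvgn (series (fun n => gamma ^+ n * Rintegral (kiter T n s) [set: S] Rf)))
  (HcvgThat : cvgn (series (fun n => gamma ^+ n * Rintegral (kiter That n s) [set: S] Rf))) :
  0 <= Num.min KF KT -> gamma * Num.min KF KT < 1 ->
  `|value T Rf gamma s - value That Rf gamma s|
    <= gamma * KR * Delta / ((1 - gamma) * (1 - gamma * Num.min KF KT)).
Proof.
set K := Num.min KF KT => K0 gK1.
have [KR0 RfL] := lipc_lipschitz_with _ HdS _ _ HKR.
have /andP[KF0 KT0] : (0 <= KF) && (0 <= KT) by rewrite -le_min.
have close y (f : S -> R) (L M : R) : 0 <= L -> lipschitz_with dS L f ->
    (forall x, `|f x| <= M) ->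
    `|Rintegral (That y) setT f - Rintegral (T y) setT f| <= L * Delta.
  move=> L0 fL fM.
  by apply: (Rintegral_dist_le_Wass _ HdS Hborel _ _ _ M); rewrite ?prob_kernel.
(* The zero function is a competitor, so every Wasserstein distance is nonnegative. *)
have Delta0 : 0 <= Delta.
  rewrite -lee_fin; apply: le_trans (HDelta s); apply: ereal_sup_ubound => /=.
  exists (fun=> 0); first by move=> x y; rewrite subrr normr0; case: HdS.
  by rewrite !integral0 subee.
have iter_close n (f : S -> R) (M : R) : lipschitz_with dS KR f ->
    (forall x, `|f x| <= M) ->
    `|Rintegral (kiter T n s) setT f - Rintegral (kiter That n s) setT f|
      <= KR * Delta * \sum_(i < n) K ^+ i.
  (* The kernel with the smaller constant plays the Lipschitz role: [That] in the first case, after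
     swapping the two sides, and [T] in the second. *)
  move=> fL fM; rewrite /K; have [_|_] := leP KF KT.
    rewrite distrC.
    apply: (kiter_Rintegral_dist _ HdS Hborel _ _ _ _ KF0 _ close _ _ _ _ M) => //.
    apply: (mixture_lipschitz_kernel _ HdS Hborel _ F g) => //.
    exact: (lipc_sup_le _ HdS _ _ _ KF0 HKF).
  apply: (kiter_Rintegral_dist _ HdS Hborel _ _ _ _ KT0 _ _ _ _ _ _ M) => //.
    exact: (Wass_lipschitz_kernel _ HdS Hborel _ _ KT0 HKT).
  by move=> y h L N L0 hL hN; rewrite distrC; exact: (close _ _ _ N).
have Rf_close n :
    `|Rintegral (kiter T n s) setT Rf - Rintegral (kiter That n s) setT Rf|
      <= KR * Delta * \sum_(i < n) K ^+ i.
  apply: (Rintegral_dist_truncation dS _ _ _ KR) => // h M hL hM.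
  exact: iter_close hM.
apply: lim_series_dist_le => // N.
apply: (@le_trans _ _ (KR * Delta *
  \sum_(n < N) gamma ^+ n * \sum_(i < n) K ^+ i)).
  rewrite mulr_sumr; apply: ler_sum => n _.
  have [g0 _] := andP Hgamma.
  rewrite -mulrBr normrM ger0_norm ?exprn_ge0// [leRHS]mulrCA.
  by apply: ler_wpM2l; rewrite ?exprn_ge0.
rewrite [gamma * KR * Delta](_ : _ = KR * Delta * gamma); last by ring.
rewrite -[leRHS]mulrA.
apply: ler_wpM2l; first exact: mulr_ge0.
exact: discounted_geometric_sum_le.
Qed.
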